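(* Let $T>0$, $\tau>0$, $\varepsilon>0$, and let $(\theta_k,v_k)$, $\hat u_k=\Phi(\theta_k)$, be generated by the semi-implicit Euler DFI scheme with step sizes $h_k>0$ and times $t_0=0$, $t_{k+1}=t_k+h_k$ as described in the context. Suppose that the flow stability and regularity conditions (i)--(iii) of the context hold with constants $\ell\in\mathbb{R}$, $C_\Phi\ge0$, $c_\Phi\ge0$, $C_a\ge0$, and that there is a constant $c_\Delta\ge0$ such that $h_k\Delta_k\le c_\Delta\varepsilon^2$ for all $k$. Let $u(t)$ denote the exact solution of $\dot u=F(u)$ with $u(0)=\hat u_0$. Then for every $k\ge1$ with $t_k\le T$, $$\|\hat u_k-u(t_k)\|_H\le\sum_{j=0}^{k-1}e^{\ell(t_k-t_{j+1})}\Bigl[h_j\Delta_j+C_\Phi h_j^2\|f_j\|_H^2+c_\Delta\Bigl(C_\Phi\varepsilon^2+\frac{c_\Phi}{2}\Bigr)h_j\Delta_j+\frac{C_a}{2}h_j^2\Bigr].$$ Moreover, set $\bar\Delta_{k-1}:=\max_{0\le j\le k-1}\Delta_j$, $\bar h:=\max_{0\le j\le k-1}h_j$ and $\bar F_{k-1}:=\max_{0\le j\le k-1}\|f_j\|_H$. Then there exists a constant $C_T>0$, depending only on $T$, $\ell$ and universal numerical constants, such that for every $k\ge 1$ with $t_k\le T$, $$\|\hat u_k-u(t_k)\|_H\le C_T\Bigl[\Bigl(1+c_\Delta\Bigl(C_\Phi\varepsilon^2+\frac{c_\Phi}{2}\Bigr)\Bigr)\bar\Delta_{k-1}+\bar h\Bigl(C_\Phi\bar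 F_{k-1}^2+\frac{C_a}{2}\Bigr)\Bigr].$$
   Context: $H$ is a real Hilbert space, $\Theta$ is a finite-dimensional real Hilbert space, $\Phi:\Theta\to H$ is of class $C^2$, and $F:H\to H$ is a vector field whose evolution equation $\dot u=F(u)$ has an exact flow $\varphi_t:H\to H$, i.e. the solution with initial value $u(0)$ is $u(t)=\varphi_t(u(0))$, and $\varphi_{s+t}=\varphi_s\circ\varphi_t$. For $\theta\in\Theta$, $J(\theta)w:=D\Phi(\theta)[w]$ and $J(\theta)^*$ is the adjoint of $J(\theta):\Theta\to H$. Scheme: given $(\theta_k,v_k)\in\Theta\times\Theta$, put $\hat u_k:=\Phi(\theta_k)$, $J_k:=J(\theta_k)$, $f_k:=F(\hat u_k)$; the next iterate $(\theta_{k+1},v_{k+1})$ is the unique solution of $$\tau^2\frac{v_{k+1}-v_k}{h_k}=-J_k^*(J_kv_{k+1}-f_k)-\varepsilon^2v_{k+1},\qquad \theta_{k+1}=\theta_k+h_kv_{k+1}.$$ Discrete defect $\Delta_k\ge0$: $$\Delta_k^2:=\|J_kv_{k+1}-f_k\|_H^2+\varepsilon^2\|v_{k+1}\|_\Theta^2+\frac{\tau^2}{h_k}\|v_{k+1}-v_k\|_\Theta^2 .$$ Flow stability and regularity conditions: (i) $\|\varphi_t(u)-\varphi_t(\widetilde u)\|_H\le e^{\ell t}\|u-\widetilde u\|_H$ for $0\le t\le T$ and all relevant states $u,\widetilde u$; (ii) $\|D^2\Phi(\theta+s\zeta)[\xi,\xi]\|_H\le C_\Phi\|J(\theta)\xi\|_H^2+c_\Phi\|\xi\|_\Theta^2$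 for $0\le s\le1$ and all relevant $\theta,\zeta,\xi\in\Theta$; (iii) for every relevant initial state $w$, the exact trajectory $y(s)=\varphi_s(w)$ is twice continuously differentiable and satisfies $\|\ddot y(s)\|_H\le C_a$ for all relevant times $s$. Here ''relevant'' means: in (i), the pairs $u=\hat u_{k+1}$, $\widetilde u=\varphi_{h_k}(\hat u_k)$ for all steps $k$; in (ii), $\theta=\theta_k$, $\zeta=h_kv_{k+1}$, $\xi=v_{k+1}$ for all steps $k$; in (iii), $w=\hat u_k$ and $0\le s\le h_k$ for all steps $k$. *)

(* Defs.v *)
(* MathComp / MathComp-Analysis *)
From HB Require Import structures.
From mathcomp Require Import all_boot all_order all_algebra.
From mathcomp Require Import sesquilinear.
From mathcomp Require Import all_classical all_reals all_analysis.

Set Implicit Arguments.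
Unset Strict Implicit.
Unset Printing Implicit Defensive.

Import Order.TTheory GRing.Theory Num.Theory.
Import numFieldNormedType.Exports.

Local Open Scope classical_set_scope.
Local Open Scope ring_scope.

HB.mixin Record isHilbert (R : realType) H & CompleteNormedModule R H := {
  inner : {dot H for (@idfun R)} ;
  inner_norm : forall x : H, `|x| ^+ 2 = inner x x }.

#[short(type="hilbertType")]
HB.structure Definition Hilbert (R : realType) :=
  {H of isHilbert R H & CompleteNormedModule R H}.

#[short(type="finHilbertType")]
HB.structure Definition FinHilbert (R : realType) :=
  {H of Hilbert R H & Vector R H}.

(* [adjoint A x] is the vector [y] with <y, w> = <x, A w> for all [w]; it exists
   and is unique because the domain is finite-dimensional (see [adjointP] and
   [adjoint_unique]), so the default value [0] of [xget] is never used. *)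
Definition adjoint (R : realType) (V : finHilbertType R) (H : hilbertType R)
    (A : {linear V -> H}) (x : H) : V :=
  xget 0 [set y : V | forall w : V, inner y w = inner x (A w)].

Lemma inner_eq0 (R : realType) (H : hilbertType R) (x : H) :
  inner x x = 0 -> x = 0.
Proof.
by rewrite -inner_norm => /eqP; rewrite sqrf_eq0 normr_eq0 => /eqP.
Qed.

Lemma adjoint_exists (R : realType) (V : finHilbertType R) (H : hilbertType R)
    (A : {linear V -> H}) (x : H) :
  exists y : V, forall w : V, inner y w = inner x (A w).
Proof.
pose b := vbasis (fullv : {vspace V}).
pose G := \matrix_(i, j) inner b`_i b`_j : 'M[R]_(\dim (fullv : {vspace V})).
pose comb (c : 'rV[R]_(\dim (fullv : {vspace V}))) : V := \sum_i c 0 i *: b`_i.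
have combE c j : (c *m G) 0 j = inner (comb c) b`_j.
  rewrite mxE /comb linear_sumlz; apply: eq_bigr => i _.
  by rewrite mxE linearZl.
have bV : basis_of fullv b := vbasisP fullv.
have Gunit : G \in unitmx.
  rewrite -row_free_unit -kermx_eq0; apply/rowV0P => c /sub_kermxP cG.
  have c0 : comb c = 0.
    apply: inner_eq0; rewrite {2}/comb linear_sum big1// => i _.
    by rewrite linearZ/= -combE cG mxE mulr0.
  have/freeP/(_ (c 0) c0) c00 := basis_free bV.
  by apply/rowP => i; rewrite c00 mxE.
exists (comb ((\row_j inner x (A b`_j)) *m invmx G)) => w.
have -> : w = \sum_i coord b i w *: b`_i by apply: (coord_basis bV); rewrite memvf.
rewrite !linear_sum; apply: eq_bigr => i _.
by rewrite !linearZ/= -combE -mulmxA mulVmx// mulmx1 mxE.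
Qed.

Lemma adjointP (R : realType) (V : finHilbertType R) (H : hilbertType R)
    (A : {linear V -> H}) (x : H) (w : V) :
  inner (adjoint A x) w = inner x (A w).
Proof.
rewrite /adjoint; case: xgetP => [y _ /(_ w)//|].
by have [y yP] := adjoint_exists A x => /(_ y); rewrite /=.
Qed.

Lemma adjoint_unique (R : realType) (V : finHilbertType R) (H : hilbertType R)
    (A : {linear V -> H}) (x : H) (y : V) :
  (forall w : V, inner y w = inner x (A w)) -> y = adjoint A x.
Proof.
move=> yP; apply/eqP; rewrite -subr_eq0; apply/eqP/inner_eq0.
by rewrite linearBl/= yP adjointP subrr.
Qed.

Section ParametrizedScheme.
Context {R : realType} {V : finHilbertType R} {H : hilbertType R}.

Definition Jac (Phi : V -> H) (th : V) : {linear V -> H} := 'd Phi th.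

Definition D2 (Phi : V -> H) (th xi zeta : V) : H :=
  'd (fun th' => Jac Phi th' zeta) th xi.

(* Fréchet C^2. The last two clauses say, through the operator norm written out,
   that [th |-> Jac Phi th] is differentiable from V to L(V, H) with derivative
   [D2 Phi th], and that [D2 Phi] is continuous. *)
Definition C2 (Phi : V -> H) : Prop :=
  [/\ forall th, differentiable Phi th,
      forall th zeta, differentiable (fun th' => Jac Phi th' zeta) th,
      forall th (e : R), 0 < e -> \forall xi \near (0 : V), forall zeta,
        `|Jac Phi (th + xi) zeta - Jac Phi th zeta - D2 Phi th xi zeta|
          <= e * `|xi| * `|zeta|
    & forall th (e : R), 0 < e -> \forall th' \near th, forall xi zeta,
        `|D2 Phi th' xi zeta - D2 Phi th xi zeta| <= e * `|xi| * `|zeta|].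

(* One-sided at the end points of an interval [D]. *)
Definition has_deriv_within (D : set R) (y : R -> H) (t : R) (d : H) : Prop :=
  h^-1 *: (y (t + h) - y t) @[h --> within [set h | D (t + h)] (0 : R)^'] --> d.

(* Only the values of [u] at nonnegative times matter. *)
Definition is_solution (F : H -> H) (u : R -> H) : Prop :=
  forall t, 0 <= t -> has_deriv_within `[0, +oo[ u t (F (u t)).

(* Forward flow: for every initial value [w] there is exactly one solution on
   [0, +oo[, namely [t |-> phi t w]. Taking [u t := phi t w] in the equivalence
   gives existence and [phi 0 w = w]. *)
Definition is_exact_flow (F : H -> H) (phi : R -> H -> H) : Prop :=
  (forall (w : H) (u : R -> H),
     (is_solution F u /\ u 0 = w) <-> (forall t, 0 <= t -> u t = phi t w)) /\
  (forall s t, 0 <= s -> 0 <= t -> phi (s + t) =1 phi s \o phi t).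

Definition C2_on_with_bound (h : R) (y : R -> H) (C : R) : Prop :=
  exists y' y'' : R -> H,
    [/\ forall s, s \in `[0, h] -> has_deriv_within `[0, h] y s (y' s),
        forall s, s \in `[0, h] -> has_deriv_within `[0, h] y' s (y'' s),
        {within `[0, h], continuous y''}
      & forall s, s \in `[0, h] -> `|y'' s| <= C].

Section Scheme.
Variables (Phi : V -> H) (F : H -> H) (phi : R -> H -> H).
Variables (tau eps : R) (h : nat -> R) (th v : nat -> V).

Definition uhat (k : nat) : H := Phi (th k).

Definition fhat (k : nat) : H := F (uhat k).

Definition dfi_scheme : Prop :=
  forall k : nat,
    let J := Jac Phi (th k) in
    (tau ^+ 2) *: ((h k)^-1 *: (v k.+1 - v k))
      = - adjoint J (J (v k.+1) - fhat k) - (eps ^+ 2) *: v k.+1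
    /\ th k.+1 = th k + h k *: v k.+1.

Definition defect (k : nat) : R :=
  Num.sqrt (`|Jac Phi (th k) (v k.+1) - fhat k| ^+ 2
            + eps ^+ 2 * `|v k.+1| ^+ 2
            + tau ^+ 2 / h k * `|v k.+1 - v k| ^+ 2).

Definition flow_stability (T l : R) : Prop :=
  forall (k : nat) (t : R), 0 <= t <= T ->
    `|phi t (uhat k.+1) - phi t (phi (h k) (uhat k))|
      <= expR (l * t) * `|uhat k.+1 - phi (h k) (uhat k)|.

Definition curvature_bound (CPhi cPhi : R) : Prop :=
  forall (k : nat) (s : R), 0 <= s <= 1 ->
    `|D2 Phi (th k + s *: (h k *: v k.+1)) (v k.+1) (v k.+1)|
      <= CPhi * `|Jac Phi (th k) (v k.+1)| ^+ 2 + cPhi * `|v k.+1| ^+ 2.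

Definition trajectory_regularity (Ca : R) : Prop :=
  forall k : nat, C2_on_with_bound (h k) (fun s => phi s (uhat k)) Ca.

End Scheme.

End ParametrizedScheme.

(* The maximum of [x 0, ..., x k.-1] when [0 < k]. *)
Definition max_below {R : realType} (x : nat -> R) (k : nat) : R :=
  \big[Num.max/x 0]_(j < k) x j.

(* Main.v *)
Require Import Defs.
From HB Require Import structures.
From mathcomp Require Import all_boot all_order all_algebra.
From mathcomp Require Import sesquilinear.
From mathcomp Require Import ring lra.
From mathcomp Require Import all_classical all_reals all_analysis.

Set Implicit Arguments.
Unset Strict Implicit.
Unset Printing Implicit Defensive.

Import Order.TTheory GRing.Theory Num.Theory.
Import numFieldNormedType.Exports.

Local Open Scope classical_set_scope.
Local Open Scope ring_scope.

(** One step of the scheme, compared with the exact flow started at the same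
    state $\hat u_k$, splits into three pieces:
    $$\hat u_{k+1}-\varphi_{h_k}(\hat u_k)
      = [\Phi(\theta_k+h_kv_{k+1})-\Phi(\theta_k)-h_kJ_kv_{k+1}]
        + h_k(J_kv_{k+1}-f_k)
        - [\varphi_{h_k}(\hat u_k)-\hat u_k-h_kf_k].$$
    The outer two are second-order Taylor remainders of curves in $H$, along
    the segment from $\theta_k$ to $\theta_{k+1}$ and along the exact
    trajectory; [taylor2_le] bounds both. The middle one is at most
    $h_k\Delta_k$ by definition of the defect. In the first remainder the
    curvature bound leaves $\|J_kv_{k+1}\|^2\le 2\|f_k\|^2+2\Delta_k^2$ and
    $\|v_{k+1}\|^2\le\Delta_k^2/\varepsilon^2$, and the step restriction
    $h_k\Delta_k\le c_\Delta\varepsilon^2$ turns each $h_k^2\Delta_k^2$ into a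
    multiple of $h_k\Delta_k$. This is [local_error_le].

    The local errors are propagated by exact flows to time $t_k$, where they
    add up with the weights $e^{\ell(t_k-t_{j+1})}$; this is
    [lady_windermere_fan]. For the uniform estimate each weight is at most
    $e^{|\ell|T}$, each local error is $h_j$ times the bracket, and
    $\sum_{j<k}h_j=t_k\le T$, so that $C_T=Te^{|\ell|T}$ works.

    The Taylor estimate for curves in $H$ reduces to real functions by pairing
    the curve with its own total increment, so only the scalar mean
    value theorem and the Cauchy-Schwarz inequality enter. *)

(** * The inner product *)

Lemma inner_le_norm (R : realType) (H : hilbertType R) (x y : H) :
  inner x y <= `|x| * `|y|.
Proof.
have [->|x0] := eqVneq x 0; first by rewrite linear0l normr0 mul0r.
have [->|y0] := eqVneq y 0; first by rewrite linear0r normr0 mulr0.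
have xy_gt0 : 0 < `|x| * `|y| by rewrite mulr_gt0 ?normr_gt0.
have innerC : inner y x = inner x y by rewrite hermC /= expr0 mul1r.
(* $\| \|y\|x-\|x\|y \|^2 = 2\|x\|\|y\| (\|x\|\|y\|-\langle x,y\rangle)$. *)
have := sqr_ge0 `| `|y| *: x - `|x| *: y|.
rewrite inner_norm linearBl !linearBr /= !linearZl /= !linearZr /=.
rewrite innerC -!inner_norm => pos.
rewrite /GRing.scale /= in pos.
have : 0 <= `|x| * `|y| * (`|x| * `|y| - inner x y) by lra.
by rewrite pmulr_rge0// subr_ge0.
Qed.

Lemma cvg_inner (R : realType) (H : hilbertType R) (T : Type)
    (F : set_system T) (FF : Filter F) (e : H) (q : T -> H) (d : H) :
  q x @[x --> F] --> d -> inner e (q x) @[x --> F] --> inner e d.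
Proof.
move=> /cvgr_dist_lt qd; apply/cvgrPdist_lt => r r0.
have e1 : 0 < `|e| + 1 by rewrite ltr_wpDl.
near=> x.
have bound z : `|inner e z| <= `|e| * `|z|.
  by rewrite ler_norml inner_le_norm lerNl -linearNr -(normrN z) inner_le_norm.
rewrite -linearBr (le_lt_trans (bound _))//.
have : `|d - q x| < r / (`|e| + 1) by near: x; apply: qd; rewrite divr_gt0.
rewrite ltr_pdivlMr//; apply: le_lt_trans.
by rewrite mulrC ler_wpM2l// lerDl.
Unshelve. all: by end_near. Qed.

(** * Curves in a Hilbert space *)

Section Curves.
Context {R : realType} {H : hilbertType R}.
Implicit Types (z : R -> H) (D : set R).

Lemma has_deriv_within_subset D E z s d :
  D `<=` E -> has_deriv_within E z s d -> has_deriv_within D z s d.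
Proof.
move=> DE; apply: cvg_trans; apply: cvg_app.
by apply: within_subset => h /=; exact: DE.
Qed.

Lemma derive_has_deriv_within (V : normedModType R) (g : V -> H) x w D t :
  differentiable g (x + t *: w) ->
  has_deriv_within D (fun s => g (x + s *: w)) t ('d g (x + t *: w) w).
Proof.
move=> dg; have := @diff_derivable _ _ _ g _ w dg.
move=> /cvg_ex [l gl]; have := @deriveE _ _ _ g _ w dg; rewrite /derive.
rewrite (cvg_lim (@norm_hausdorff _ _) gl) => <-.
apply: cvg_within_filter; move: gl; apply: cvg_trans.
apply: near_eq_cvg; near=> h; rewrite /= scalerDl addrCA [h *: w + _]addrC.
by rewrite addrCA.
Unshelve. all: by end_near. Qed.

Lemma has_deriv_within_sub_linear D z s d (a : H) :
  has_deriv_within D z s d ->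
  has_deriv_within D (fun r => z r - r *: a) s (d - a).
Proof.
move=> zd; have zda := cvgB zd (cvg_cst a).
apply: cvg_trans (zda _ _); apply: near_eq_cvg; near=> h.
have h0 : h != 0.
  by near: h; apply: cvg_within; exact: (@nbhs_dnbhs_neq R 0).
rewrite /= !fctE; apply: (scalerI h0).
rewrite scalerBr !scalerA mulfV// !scale1r.
by rewrite scalerDl [s *: a + _]addrC opprD opprB !addrA subrK addrAC.
Unshelve. all: by end_near. Qed.

Lemma has_deriv_within_continuous b z z' :
  (forall s, s \in `[0, b] -> has_deriv_within `[0, b] z s (z' s)) ->
  forall s, s \in `[0, b] -> z x @[x --> within `[0, b] (nbhs s)] --> z s.
Proof.
move=> dz s sb; apply/cvgrPdist_lt => r r0.
have /cvgr_dist_lt/(_ _ ltr01) := dz s sb.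
rewrite /within/= /dnbhs/within /= => /nbhs_ballP[del /= del0 zs].
have c0 : 0 < `|z' s| + 1 by rewrite ltr_wpDl.
apply/nbhs_ballP.
(* Within distance del of $s$ the difference quotient is below $\|z'(s)\|+1$. *)
exists (Num.min del (r / (`|z' s| + 1))) => /=; first by rewrite lt_min del0 divr_gt0.
move=> x; rewrite /ball/= lt_min => /andP[xdel xr] xb.
have [->|xs] := eqVneq x s; first by rewrite subrr normr0.
have := zs (x - s); rewrite /ball/= sub0r normrN distrC => /(_ xdel).
rewrite subr_eq0 addrC subrK => /(_ xs xb).
rewrite distrC => q1.
have dx : x - s != 0 by rewrite subr_eq0.
rewrite distrC -[z x - z s]scale1r -(mulfV dx) -scalerA normrZ.
rewrite -[r in ltRHS](divfK (lt0r_neq0 c0)) ltr_pM// 1?distrC//.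
rewrite -[_ *: _](subrK (z' s)) (le_lt_trans (ler_normD _ _))//.
by rewrite addrC ltrD2l.
Qed.

Lemma is_derive_inner b z s d e :
  s \in `]0, b[ -> has_deriv_within `[0, b] z s d ->
  is_derive s (1 : R) (fun r => inner e (z r)) (inner e d).
Proof.
move=> sb zd.
have gd : h^-1 *: (((fun r => inner e (z r)) \o shift s) (h *: (1 : R))
    - inner e (z s)) @[h --> (0 : R)^'] --> inner e d.
  have nb : \forall h \near (0 : R)^', s + h \in `[0, b].
    move: sb; rewrite in_itv /= => /andP[s0 sb].
    near=> h.
    have : `|h| < Num.min s (b - s).
      by near: h; apply: dnbhs0_lt; rewrite lt_min s0 subr_gt0.
    rewrite lt_min !ltr_norml in_itv /= => /andP[] /andP[? ?] /andP[? ?].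
    by apply/andP; split; lra.
  have : h^-1 *: (z (s + h) - z s) @[h --> (0 : R)^'] --> d.
    apply: cvg_trans zd => A; rewrite /= /within /= !near_simpl => nA.
    by apply: filterS2 nb nA => h sh; apply.
  move=> /(@cvg_inner _ _ _ _ _ e); apply: cvg_trans.
  apply: near_eq_cvg; near=> h.
  by rewrite linearZr linearBr /= -[h%:A]/(h * 1) mulr1 [h + s]addrC.
by split; [apply/cvg_ex; exists (inner e d) | apply: cvg_lim].
Unshelve. all: by end_near. Qed.

(** With $e=z(b)-z(0)$, the real function $\|e\|B-\langle e,z\rangle$ is
    nondecreasing, because its derivative is at least
    $\|e\|(B'-\|z'\|)\ge0$; its increment over $[0,b]$ is
    $\|e\|(B(b)-B(0)-\|e\|)$, and division by $\|e\|$ concludes. *)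
Lemma mean_value_le b z z' (B B' : R -> R) : 0 < b ->
  (forall s, s \in `[0, b] -> has_deriv_within `[0, b] z s (z' s)) ->
  (forall s, is_derive s (1 : R) B (B' s)) ->
  (forall s, s \in `]0, b[ -> `|z' s| <= B' s) ->
  `|z b - z 0| <= B b - B 0.
Proof.
move=> b0 dz dB z'B.
have cB : continuous B.
  by move=> x; apply/differentiable_continuous/derivable1_diffP.
set e := z b - z 0.
have [->|e0] := eqVneq e 0.
  have [c cb ->] := MVT b0 (fun s _ => dB s) (continuous_subspaceT cB).
  by rewrite normr0 mulr_ge0 ?subr0 ?(ltW b0)// (le_trans (normr_ge0 (z' c)))// z'B.
pose G s : R := `|e| * B s - inner e (z s).
have dG s : s \in `]0, b[ -> is_derive s 1 G (`|e| * B' s - inner e (z' s)).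
  move=> sb; have dBs := dB s.
  have dzs := is_derive_inner e sb (dz s (subset_itv_oo_cc sb)).
  have dcB : is_derive s (1 : R) (`|e| \*: B) (`|e| *: B' s) by exact: is_deriveZ.
  exact: is_deriveB.
have cG : {within `[0, b], continuous G}.
  apply/subspace_continuousP => s sb; apply: cvgB.
    by apply: cvgMr; apply: cvg_within_filter; exact: cB.
  by apply: cvg_inner; apply: (has_deriv_within_continuous dz).
have [c cb Gc] := MVT b0 dG cG.
have : 0 <= G b - G 0.
  rewrite Gc mulr_ge0 ?subr0 ?(ltW b0)// subr_ge0 (le_trans (inner_le_norm _ _))//.
  by rewrite ler_wpM2l// z'B.
have : inner e (z b) - inner e (z 0) = `|e| ^+ 2 by rewrite -linearBr inner_norm.
rewrite /G => ie pos.
have : 0 <= `|e| * (B b - B 0 - `|e|) by lra.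
by rewrite pmulr_rge0 ?normr_gt0// subr_ge0.
Qed.

(** The mean value inequality is applied twice: to $z'$, with majorant $Cs$,
    and then to $s\mapsto z(s)-sz'(0)$, with majorant $Cs^2/2$. *)
Lemma taylor2_le b z z' z'' (C : R) : 0 < b ->
  (forall s, s \in `[0, b] -> has_deriv_within `[0, b] z s (z' s)) ->
  (forall s, s \in `[0, b] -> has_deriv_within `[0, b] z' s (z'' s)) ->
  (forall s, s \in `[0, b] -> `|z'' s| <= C) ->
  `|z b - z 0 - b *: z' 0| <= C / 2 * b ^+ 2.
Proof.
move=> b0 dz dz' z''C.
have z'C s : s \in `]0, b[ -> `|z' s - z' 0| <= C * s.
  rewrite in_itv /= => /andP[s0 sb].
  have sub r : r \in `[0, s] -> r \in `[0, b].
    by rewrite !in_itv /= => /andP[-> rs] /=; lra.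
  have -> : C * s = C * s - C * 0 by rewrite mulr0 subr0.
  apply: (@mean_value_le s z' z'' ( *%R C) (fun=> C)) => // [r rs|r|r rs].
    apply: has_deriv_within_subset (dz' r (sub r rs)) => x; exact: sub.
    apply: is_derive_eq (is_deriveZ C (is_derive_id r (1 : R))) _.
    by rewrite /GRing.scale /= mulr1.
  by apply/z''C/sub/subset_itv_oo_cc.
pose w s := z s - s *: z' 0; pose B s : R := C / 2 * s ^+ 2.
have -> : z b - z 0 - b *: z' 0 = w b - w 0 by rewrite /w scale0r subr0 addrAC.
have -> : C / 2 * b ^+ 2 = B b - B 0 by rewrite /B expr0n mulr0 subr0.
apply: (@mean_value_le b w (fun s => z' s - z' 0) B (fun s => C * s)) => // [s sb|s].
  exact/has_deriv_within_sub_linear/dz.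
have -> : B = (C / 2) \*: (id : R -> R) ^+ 2 by [].

have dX := is_deriveX 2 (is_derive_id s (1 : R)).
apply: is_derive_eq (is_deriveZ (C / 2) dX) _.
by rewrite /GRing.scale /= expr1 mulr1 mulrA divfK// pnatr_eq0.
Qed.
End Curves.

(** The punctured right neighbourhoods of 0 meet $[0,b]$, so one-sided
    derivatives at the left end point are unique. *)
Lemma has_deriv_within_unique0 (R : realType) (H : hilbertType R) (b : R)
    (z : R -> H) (d d' : H) : 0 < b ->
  has_deriv_within `[0, b] z 0 d -> has_deriv_within `[0, b] z 0 d' -> d = d'.
Proof.
move=> b0 zd zd'.
have right e : has_deriv_within `[0, b] z 0 e ->
    h^-1 *: (z (0 + h) - z 0) @[h --> (0 : R)^'+] --> e.
  apply: cvg_trans => A nA.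
  have {}nA : \forall h \near (0 : R), h != 0 -> 0 + h \in `[0, b] ->
    A (h^-1 *: (z (0 + h) - z 0)) by exact: nA.
  have nb : \forall h \near (0 : R), h < b := lt_nbhsl b0.
  suff : \forall h \near (0 : R), 0 < h -> A (h^-1 *: (z (0 + h) - z 0)) by [].
  apply: filterS2 nb nA => h hb + h0; apply; first by rewrite gt_eqF.
  by rewrite add0r in_itv /= !ltW.
exact: cvg_unique (right _ zd) (right _ zd').
Qed.

(** * Exact flows and error propagation *)

Section Flow.
Context {R : realType} {H : hilbertType R} (F : H -> H) (phi : R -> H -> H).
Context (flow : is_exact_flow F phi).

Lemma flow_solution w : is_solution F (phi^~ w) /\ phi 0 w = w.
Proof. exact: (proj1 flow w (phi^~ w)).2. Qed.

Lemma flow_taylor2_le h w Ca : 0 < h ->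
  C2_on_with_bound h (fun s => phi s w) Ca ->
  `|phi h w - w - h *: F w| <= Ca / 2 * h ^+ 2.
Proof.
move=> h0 [y' [y'' [dy dy' _ y''C]]]; have [sol phi0] := flow_solution w.
have h00 : 0 \in `[0, h] by rewrite in_itv /= lexx ltW.
(* The derivative on $[0,h]$ at 0 and the one on $[0,\infty)$ given by the
   evolution equation agree, hence the linear term is $hF(w)$. *)
have y'0 : y' 0 = F w.
  apply: has_deriv_within_unique0 h0 (dy _ h00) _.
  rewrite -[in F _]phi0; apply: has_deriv_within_subset (sol 0 (lexx _)) => s /=.
  by rewrite !in_itv /= => /andP[->].
by have := taylor2_le h0 dy dy' y''C; rewrite phi0 y'0.
Qed.

(** Telescoping over the exact solutions started at each numerical state and
    followed up to $t_k$: consecutive ones are at time $t_{n+1}$ at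
    $\varphi_{h_n}(x_n)$ and $x_{n+1}$, that is, one local error apart, and
    stability is used only from $t_{n+1}$ to $t_k$. *)
Lemma lady_windermere_fan (T l : R) (h t : nat -> R) (x : nat -> H) (k : nat) :
  (forall n, 0 < h n) -> t 0%N = 0 -> (forall n, t n.+1 = t n + h n) ->
  t k <= T ->
  (forall n s, 0 <= s <= T ->
    `|phi s (x n.+1) - phi s (phi (h n) (x n))|
      <= expR (l * s) * `|x n.+1 - phi (h n) (x n)|) ->
  `|x k - phi (t k) (x 0%N)| <=
    \sum_(j < k) expR (l * (t k - t j.+1)) * `|x j.+1 - phi (h j) (x j)|.
Proof.
move=> h0 t0 tS tkT stab.
have t_mono : {homo t : m n / (m <= n)%N >-> m <= n}.
  by apply: homo_leq lexx le_trans _ => n; rewrite tS lerDl ltW.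
have t_ge0 n : 0 <= t n by rewrite -t0 t_mono.
suff fan n : (n <= k)%N -> `|phi (t k - t n) (x n) - phi (t k) (x 0%N)| <=
    \sum_(j < n) expR (l * (t k - t j.+1)) * `|x j.+1 - phi (h j) (x j)|.
  by have := fan k (leqnn k); rewrite subrr (flow_solution _).2.
elim: n => [_|n IH nk]; first by rewrite t0 subr0 subrr normr0 big_ord0.
have sk : 0 <= t k - t n.+1 <= T.
  by rewrite subr_ge0 t_mono//= lerBlDr (le_trans tkT)// lerDl.
have step : phi (t k - t n) (x n) = phi (t k - t n.+1) (phi (h n) (x n)).
  rewrite -[RHS](proj2 flow (t k - t n.+1) (h n) (andP sk).1 (ltW (h0 n))).
  by rewrite tS opprD addrA subrK.
rewrite big_ord_recr /= addrC.
rewrite (le_trans (ler_distD (phi (t k - t n) (x n)) _ _))// lerD ?IH 1?ltnW//.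
by rewrite step stab.
Qed.
End Flow.

(** * Local error of the scheme *)

Section Scheme.
Context {R : realType} {V : finHilbertType R} {H : hilbertType R}.
Context (Phi : V -> H) (F : H -> H) (phi : R -> H -> H).
Context (tau eps : R) (h : nat -> R) (th v : nat -> V).

(** Parametrizing the segment by $x+sw$ with $s\in[0,b]$, rather than by
    $x+s(bw)$ with $s\in[0,1]$, makes $D^2\Phi[w,w]$ itself the second
    derivative of the curve, without a factor $b^2$. *)
Lemma decoder_taylor2_le (x w : V) (b C : R) : C2 Phi -> 0 < b ->
  (forall s, s \in `[0, b] -> `|D2 Phi (x + s *: w) w w| <= C) ->
  `|Phi (x + b *: w) - Phi x - b *: Jac Phi x w| <= C / 2 * b ^+ 2.
Proof.
move=> [dPhi dJ _ _] b0 D2C.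
have := @taylor2_le _ _ b (fun s => Phi (x + s *: w))
  (fun s => Jac Phi (x + s *: w) w) (fun s => D2 Phi (x + s *: w) w w) C b0.
rewrite scale0r addr0; apply=> // s _.
  exact: derive_has_deriv_within.
exact: (@derive_has_deriv_within _ _ _ (fun y => Jac Phi y w)).
Qed.

Context (eps0 : 0 < eps) (h0 : forall k, 0 < h k).
Let D := defect Phi F tau eps h th v.

Lemma defect_bounds k :
  [/\ 0 <= D k, `|Jac Phi (th k) (v k.+1) - fhat Phi F th k| <= D k
    & eps * `|v k.+1| <= D k].
Proof.
have a0 : 0 <= `|Jac Phi (th k) (v k.+1) - fhat Phi F th k| ^+ 2 by exact: sqr_ge0.
have b0 : 0 <= eps ^+ 2 * `|v k.+1| ^+ 2 by rewrite mulr_ge0 ?sqr_ge0.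
have c0 : 0 <= tau ^+ 2 / h k * `|v k.+1 - v k| ^+ 2.
  by rewrite mulr_ge0 ?sqr_ge0// divr_ge0 ?sqr_ge0// ltW.
split; first exact: sqrtr_ge0.
  by rewrite -[leLHS]ger0_norm// -sqrtr_sqr ler_wsqrtr//; lra.
rewrite -[leLHS]ger0_norm; last by rewrite mulr_ge0// ltW.
by rewrite -sqrtr_sqr ler_wsqrtr// exprMn; lra.
Qed.

(** The sum of the two Taylor remainders and of the residual
    $h_k(J_kv_{k+1}-f_k)$. The factor 1/2 of the Taylor remainder absorbs the
    2 in $\|J_kv_{k+1}\|^2\le2\|f_k\|^2+2\Delta_k^2$, which is why
    $C_\Phi$ appears without it and $c_\Phi$ with it. *)
Lemma local_error_le k (CPhi cPhi Ca cD : R) :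
  C2 Phi -> is_exact_flow F phi -> dfi_scheme Phi F tau eps h th v ->
  0 <= CPhi -> 0 <= cPhi ->
  curvature_bound Phi h th v CPhi cPhi ->
  trajectory_regularity Phi phi h th Ca ->
  h k * D k <= cD * eps ^+ 2 ->
  `|uhat Phi th k.+1 - phi (h k) (uhat Phi th k)| <=
    h k * D k + CPhi * h k ^+ 2 * `|fhat Phi F th k| ^+ 2
    + cD * (CPhi * eps ^+ 2 + cPhi / 2) * (h k * D k) + Ca / 2 * h k ^+ 2.
Proof.
move=> C2Phi flow scheme CPhi0 cPhi0 curv reg hD.
have [D0 JD vD] := defect_bounds k.
set f := fhat Phi F th k in JD *.
pose Jv := Jac Phi (th k) (v k.+1); rewrite -/Jv in JD.
have dec : `|uhat Phi th k.+1 - uhat Phi th k - h k *: Jv| <=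
    (CPhi * `|Jv| ^+ 2 + cPhi * `|v k.+1| ^+ 2) / 2 * h k ^+ 2.
  rewrite /uhat (scheme k).2; apply: decoder_taylor2_le => // s.
  rewrite in_itv /= => /andP[s0 sh].
  (* The curvature bound samples the segment at fractions of $h_kv_{k+1}$. *)
  have := curv k (s / h k); rewrite scalerA divfK ?gt_eqF//; apply.
  by rewrite divr_ge0 ?(ltW (h0 k))//= ler_pdivrMr// mul1r.
have traj := flow_taylor2_le flow (h0 k) (reg k).
rewrite -/(fhat Phi F th k) -/f in traj.
have split_err : uhat Phi th k.+1 - phi (h k) (uhat Phi th k) =
    (uhat Phi th k.+1 - uhat Phi th k - h k *: Jv) + h k *: (Jv - f)
    - (phi (h k) (uhat Phi th k) - uhat Phi th k - h k *: f).
  rewrite scalerBr addrA subrK !opprB -addrA [- _ + _]addrC.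
  by rewrite [h k *: f + _]addrC addrK addrA subrK.
have res : `|h k *: (Jv - f)| <= h k * D k.
  by rewrite normrZ gtr0_norm// ler_wpM2l// ltW.
have hD0 : 0 <= h k * D k by rewrite mulr_ge0// ltW.
have hD2 : (h k * D k) ^+ 2 <= cD * eps ^+ 2 * (h k * D k).
  by rewrite expr2 ler_wpM2r.
have Jv2 : `|Jv| ^+ 2 <= 2 * `|f| ^+ 2 + 2 * D k ^+ 2.
  have : `|Jv| <= D k + `|f|.
    by rewrite -[Jv](subrK f) (le_trans (ler_normD _ _))// lerD2r.
  have := normr_ge0 Jv; have := normr_ge0 f; have := sqr_ge0 (`|f| - D k).
  by nra.
have v2 : (h k * `|v k.+1|) ^+ 2 <= cD * (h k * D k).
  have e2 : 0 < eps ^+ 2 by rewrite exprn_gt0.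
  rewrite -(ler_pM2l e2); apply: le_trans (_ : (h k * D k) ^+ 2 <= _); last by lra.
  have [hk ek] := (ltW (h0 k), ltW eps0).
  by rewrite -exprMn mulrCA ler_pXn2r ?nnegrE ?mulr_ge0// ler_wpM2l.
have curv_part : (CPhi * `|Jv| ^+ 2 + cPhi * `|v k.+1| ^+ 2) / 2 * h k ^+ 2 <=
    CPhi * h k ^+ 2 * `|f| ^+ 2 + cD * (CPhi * eps ^+ 2 + cPhi / 2) * (h k * D k).
  have h2 : 0 <= CPhi * h k ^+ 2 by rewrite mulr_ge0 ?sqr_ge0.
  have := ler_wpM2l h2 Jv2; have := ler_wpM2l cPhi0 v2; have := ler_wpM2l CPhi0 hD2.
  by rewrite !exprMn; lra.
rewrite split_err (le_trans (ler_normB _ _))//.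
have := ler_normD (uhat Phi th k.+1 - uhat Phi th k - h k *: Jv) (h k *: (Jv - f)).
by lra.
Qed.
End Scheme.

(** * The error estimate *)

Lemma le_max_below (R : realType) (x : nat -> R) (k j : nat) :
  (j < k)%N -> x j <= max_below x k.
Proof. by move=> jk; exact: (le_bigmax _ (fun i : 'I_k => x i) (Ordinal jk)). Qed.


Theorem proposition6 (R : realType) (T l : R) (hT : 0 < T) :
  exists2 CT : R, 0 < CT &
  forall (V : finHilbertType R) (H : hilbertType R)
    (Phi : V -> H) (F : H -> H) (phi : R -> H -> H)
    (tau eps : R) (h t : nat -> R) (th v : nat -> V)
    (CPhi cPhi Ca cD : R) (u : R -> H),
  C2 Phi ->
  is_exact_flow F phi ->
  0 < tau -> 0 < eps ->
  (forall k, 0 < h k) ->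
  t 0%N = 0 -> (forall k, t k.+1 = t k + h k) ->
  dfi_scheme Phi F tau eps h th v ->
  0 <= CPhi -> 0 <= cPhi -> 0 <= Ca ->
  flow_stability Phi phi h th T l ->
  curvature_bound Phi h th v CPhi cPhi ->
  trajectory_regularity Phi phi h th Ca ->
  0 <= cD ->
  (forall k, h k * defect Phi F tau eps h th v k <= cD * eps ^+ 2) ->
  is_solution F u -> u 0 = uhat Phi th 0%N ->
  let D := defect Phi F tau eps h th v in
  let nf := fun j => `|fhat Phi F th j| in
  (forall k : nat, (1 <= k)%N -> t k <= T ->
     `|uhat Phi th k - u (t k)| <=
       \sum_(j < k) expR (l * (t k - t j.+1)) *
         (h j * D j + CPhi * h j ^+ 2 * nf j ^+ 2
          + cD * (CPhi * eps ^+ 2 + cPhi / 2) * (h j * D j)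
          + Ca / 2 * h j ^+ 2)) /\
  (forall k : nat, (1 <= k)%N -> t k <= T ->
     `|uhat Phi th k - u (t k)| <=
       CT * ((1 + cD * (CPhi * eps ^+ 2 + cPhi / 2)) * max_below D k
             + max_below h k * (CPhi * max_below nf k ^+ 2 + Ca / 2))).
Proof.

exists (expR (`|l| * T) * T); first by rewrite mulr_gt0// expR_gt0.
move=> V H Phi F phi tau eps h t th v CPhi cPhi Ca cD u C2Phi flow _ eps0 h0 t0 tS.
move=> scheme CPhi0 cPhi0 Ca0 stab curv reg cD0 hD sol u0 D nf.
have t_mono : {homo t : m n / (m <= n)%N >-> m <= n}.
  by apply: homo_leq lexx le_trans _ => n; rewrite tS lerDl ltW.
have uE s : 0 <= s -> u s = phi s (uhat Phi th 0).
  by move: s; apply/(proj1 flow).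
have D0 j : 0 <= D j by case: (@defect_bounds _ _ _ Phi F tau eps h th v eps0 h0 j).
set K := cD * (CPhi * eps ^+ 2 + cPhi / 2).
have K0 : 0 <= K by rewrite mulr_ge0// addr_ge0 ?divr_ge0// mulr_ge0 ?sqr_ge0.
have sum_bound k : t k <= T -> `|uhat Phi th k - u (t k)| <=
    \sum_(j < k) expR (l * (t k - t j.+1)) *
      (h j * D j + CPhi * h j ^+ 2 * nf j ^+ 2 + K * (h j * D j)
       + Ca / 2 * h j ^+ 2).
  move=> tkT; rewrite uE; last by rewrite -t0 t_mono.
  apply: le_trans (lady_windermere_fan flow h0 t0 tS tkT stab) _.
  apply: ler_sum => j _; rewrite ler_wpM2l ?expR_ge0//.
  exact: (local_error_le eps0 h0 C2Phi flow scheme CPhi0 cPhi0 curv reg (hD j)).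
split=> k k0 tkT; first exact: sum_bound.
apply: le_trans (sum_bound k tkT) _.
set M := (1 + K) * _ + _.
have term (j : 'I_k) : expR (l * (t k - t j.+1)) *
    (h j * D j + CPhi * h j ^+ 2 * nf j ^+ 2 + K * (h j * D j)
       + Ca / 2 * h j ^+ 2)
    <= expR (`|l| * T) * M * h j.
  have jk := ltn_ord j.
  have DM : D j <= max_below D k by exact: le_max_below.
  have hM : h j <= max_below h k by exact: le_max_below.
  have nfM : nf j <= max_below nf k by exact: (le_max_below nf).
  have nf2M : nf j ^+ 2 <= max_below nf k ^+ 2.
    by rewrite ler_pXn2r ?nnegrE ?(le_trans _ nfM)// normr_ge0.
  have CnfM : CPhi * nf j ^+ 2 + Ca / 2 <= CPhi * max_below nf k ^+ 2 + Ca / 2.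
    by rewrite lerD2r ler_wpM2l.
  have Cnf0 : 0 <= CPhi * nf j ^+ 2 + Ca / 2.
    by rewrite addr_ge0 ?divr_ge0// mulr_ge0 ?sqr_ge0.
  have -> : h j * D j + CPhi * h j ^+ 2 * nf j ^+ 2 + K * (h j * D j)
        + Ca / 2 * h j ^+ 2
      = ((1 + K) * D j + h j * (CPhi * nf j ^+ 2 + Ca / 2)) * h j by ring.
  rewrite -mulrA ler_pM ?expR_ge0//.
  - apply: mulr_ge0 (ltW (h0 j)); apply: addr_ge0; apply: mulr_ge0 => //.
      exact: addr_ge0.
    exact: ltW (h0 j).
  - have tj0 : 0 <= t k - t j.+1 by rewrite subr_ge0 t_mono.
    have tjT : t k - t j.+1 <= T by rewrite lerBlDr (le_trans tkT)// lerDl -t0 t_mono.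
    by rewrite ler_expR (le_trans (ler_norm _))// normrM (ger0_norm tj0) ler_wpM2l.
  - rewrite ler_wpM2r ?(ltW (h0 j))// lerD//; first by rewrite ler_wpM2l// addr_ge0.
    by rewrite ler_pM// ltW.
have sum_h : \sum_(j < k) h j = t k.
  transitivity (\sum_(0 <= j < k) (t j.+1 - t j)); last first.
    by rewrite telescope_sumr// t0 subr0.
  by rewrite big_mkord; apply: eq_bigr => j _; rewrite tS addrAC subrr add0r.
apply: le_trans (ler_sum _ (fun j _ => term j)) _.
have M0 : 0 <= M.
  apply: addr_ge0; apply: mulr_ge0.
  - exact: addr_ge0.
  - exact: le_trans (D0 0%N) (le_max_below D k0).
  - exact: le_trans (ltW (h0 0%N)) (le_max_below h k0).
  - by rewrite addr_ge0 ?divr_ge0// mulr_ge0 ?sqr_ge0.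
by rewrite -mulr_sumr sum_h -!mulrA ler_wpM2l ?expR_ge0// [leRHS]mulrC ler_wpM2l.
Qed.
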